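(* Let $p\in\mathbb{C}[z,w]$ be a polynomial of minimal degree $(n,m)$ defining a distinguished variety, let $V=\{(z,w)\in\mathbb{C}^2:p(z,w)=0\}$, and suppose $V$ has no singularities on $\mathbb{T}^2$. Let $U=\begin{pmatrix}A&B\\ C&D\end{pmatrix}$ be an $(m+n)\times(m+n)$ unitary matrix (blocks with respect to $\mathbb{C}^m\oplus\mathbb{C}^n$), let $\Phi(z)=A+zB(I_n-zD)^{-1}C$, and let $\vec{Q}(z,w)=Q(z)(1,w,\dots,w^{m-1})^t$, where $Q(z)$ is an $m\times m$ matrix polynomial of degree at most $n$ in each entry, be such that: $D$ has no unimodular eigenvalues; $p$ is a constant multiple of $\det\begin{pmatrix}A-wI_m&zB\\ C&zD-I_n\end{pmatrix}$; $V\cap\mathbb{D}^2=\{(z,w)\in\mathbb{D}^2:\det(wI_m-\Phi(z))=0\}$; $\vec{Q}$ has at most finitely many zeros on $V\cap\mathbb{D}^2$; $\Phi(z)\vec{Q}(z,w)=w\vec{Q}(z,w)$ for all $(z,w)\in V\cap\mathbb{D}^2$; and $Q(z)$ is invertible for all $z\in\overline{\mathbb{D}}$. Then for any polynomial $f\in\mathbb{C}[z,w]$, the rational function \[ F(z,w):=(1,0,\dots,0)\,Q(z)^{-1}f(zI_m,\Phi(z))\,\vec{Q}(z,w) \] is equal to $f$ on $V\cap\overline{\mathbb{D}^2}$, and for all $(z,w)\in\mathbb{D}^2$ \[ |F(z,w)|\le\|Q(z)^{-1}\|\,|\vec{Q}(z,w)|\sup_{V\cap\mathbb{D}^2}|f|\le\sqrt{m}\,\|Q(z)^{-1}\|\,\|Q(z)\|\sup_{V\cap\mathbb{D}^2}|f|\le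 C_0\sup_{V\cap\mathbb{D}^2}|f|, \] where $C_0=\sqrt{m}\,\sup_{z\in\mathbb{D}}\|Q(z)^{-1}\|\,\|Q(z)\|$.
   Context: $\mathbb{D}$ is the open unit disk, $\mathbb{T}$ the unit circle. A non-empty set $V_0\subset\mathbb{C}^2$ is a distinguished variety if there is $p\in\mathbb{C}[z,w]$ with $V_0=\{(z,w)\in\mathbb{D}^2:p(z,w)=0\}$ and $\overline{V_0}\cap\partial(\mathbb{D}^2)=\overline{V_0}\cap\mathbb{T}^2$ (closure in $\overline{\mathbb{D}^2}$). Here $V_0$ is identified with the zero set $V$ in $\mathbb{C}^2$ of a defining polynomial $p$ of minimal degree $(n,m)$ ($n$ in $z$, $m$ in $w$), meaning that no polynomial whose zero set in $\mathbb{D}^2$ is $V_0$ has smaller degree in $z$ or smaller degree in $w$ than $p$. $V$ has no singularities on $\mathbb{T}^2$ means there is no point of $\mathbb{T}^2$ at which $p,p_z,p_w$ all vanish. $\|\cdot\|$ is the operator norm of a matrix, $|\cdot|$ the Euclidean length of a vector, and $f(zI_m,\Phi(z))$ is obtained by substituting the commuting matrices $zI_m$ and $\Phi(z)$ into $f$. *)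

(* Defs.v *)
From HB Require Import structures.
From mathcomp Require Import all_boot all_order all_algebra.
From mathcomp Require Import complex polyXY sesquilinear spectral.
From mathcomp Require Import all_classical all_reals all_analysis.

Set Implicit Arguments.
Unset Strict Implicit.
Unset Printing Implicit Defensive.

Import Order.TTheory GRing.Theory Num.Theory numFieldNormedType.Exports.

Local Open Scope classical_set_scope.
Local Open Scope complex_scope.
Local Open Scope ring_scope.

(* The R-valued modulus on R[i]; the generic norm `|z| takes values in R[i]. *)
Notation normc := ComplexField.Normc.normc.

Section BivariatePolynomials.
Variable K : nzRingType.

(* A polynomial in C[z, w] has type {poly {poly K}} with z the outer variable
   'X and w the inner variable 'Y, so that p.[z, w] is its value at (z, w). *)
Definition degz (p : {poly {poly K}}) : nat := (size p).-1.
Definition degw (p : {poly {poly K}}) : nat := (sizeY p).-1.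
Definition derivz (p : {poly {poly K}}) : {poly {poly K}} := p^`().
Definition derivw (p : {poly {poly K}}) : {poly {poly K}} :=
  map_poly (@deriv K) p.

(* f(Z, W), meaningful when the matrices Z and W commute. *)
Definition mx_eval2 m (f : {poly {poly K}}) (Z W : 'M[K]_m) : 'M[K]_m :=
  \sum_(i < size f) \sum_(j < size f`_i) f`_i`_j *: (Z ^+ i *m W ^+ j).

Definition mxpoly_eval m (Q : 'M[{poly K}]_m) (z : K) : 'M[K]_m :=
  \matrix_(i, j) (Q i j).[z].

End BivariatePolynomials.

Section Varieties.
Variable R : realType.
Local Notation C := R[i].

Definition disk : set C := [set z | normc z < 1].
Definition bidisk : set (C * C) := [set x | normc x.1 < 1 /\ normc x.2 < 1].
Definition cbidisk : set (C * C) := [set x | normc x.1 <= 1 /\ normc x.2 <= 1].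
Definition torus : set (C * C) := [set x | normc x.1 = 1 /\ normc x.2 = 1].

(* R[i] carries no canonical topology; R[i]^o is R[i] with its usual one. *)
Definition closure2 (S : set (C * C)) : set (C * C) :=
  closure (S : set (C^o * C^o)).
Definition boundary2 (S : set (C * C)) : set (C * C) :=
  closure2 S `\` interior (S : set (C^o * C^o)).

Definition zeroset (p : {poly {poly C}}) : set (C * C) :=
  [set x | p.[x.1, x.2] = 0].

Definition distinguished_variety (V0 : set (C * C)) : Prop :=
  [/\ V0 !=set0,
      exists p : {poly {poly C}}, V0 = zeroset p `&` bidisk &
      closure2 V0 `&` boundary2 bidisk = closure2 V0 `&` torus].

Definition minimal_degree (p : {poly {poly C}}) (n m : nat) : Prop :=
  [/\ degz p = n, degw p = m &
      forall q : {poly {poly C}},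
        zeroset q `&` bidisk = zeroset p `&` bidisk ->
        (n <= degz q)%N /\ (m <= degw q)%N].

Definition no_torus_singularity (p : {poly {poly C}}) : Prop :=
  ~ exists x : C * C, [/\ torus x, p.[x.1, x.2] = 0,
      (derivz p).[x.1, x.2] = 0 & (derivw p).[x.1, x.2] = 0].

Definition sup_on (V : set (C * C)) (f : {poly {poly C}}) : R :=
  sup [set normc f.[x.1, x.2] | x in V].

End Varieties.

Section Matrices.
Variable R : realType.
Local Notation C := R[i].

Definition enorm m (v : 'cV[C]_m) : R :=
  Num.sqrt (\sum_(i < m) normc (v i 0) ^+ 2).

Definition opnorm m (M : 'M[C]_m) : R :=
  sup [set enorm (M *m v) | v in [set v : 'cV[C]_m | enorm v <= 1]].

Section Realization.
Variables (m n : nat).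
Variables (A : 'M[C]_m) (B : 'M[C]_(m, n)) (Cb : 'M[C]_(n, m)) (D : 'M[C]_n).

Definition transfer (z : C) : 'M[C]_m :=
  A + z *: (B *m invmx (1%:M - z *: D) *m Cb).

Definition realization_det : {poly {poly C}} :=
  let cst := fun a : C => a%:P%:P : {poly {poly C}} in
  \det (block_mx (map_mx cst A - 'Y%:M) ('X *: map_mx cst B)
                 (map_mx cst Cb)        ('X *: map_mx cst D - 1%:M)).

End Realization.

Definition Qvec m (Q : 'M[{poly C}]_m) (z w : C) : 'cV[C]_m :=
  mxpoly_eval Q z *m \col_(j < m) w ^+ j.

Definition extension m (Q : 'M[{poly C}]_m) (Phi : C -> 'M[C]_m)
    (f : {poly {poly C}}) (z w : C) : C :=
  (\row_(j < m) (val j == 0%N)%:R *m invmx (mxpoly_eval Q z)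
     *m mx_eval2 f z%:M (Phi z) *m Qvec Q z w) 0 0.

Definition bound_const m (Q : 'M[{poly C}]_m) : R :=
  Num.sqrt m%:R * sup [set opnorm (invmx (mxpoly_eval Q z))
                           * opnorm (mxpoly_eval Q z) | z in @disk R].

End Matrices.

(* Main.v *)
(** For |z| = 1 the matrix Phi(z) is unitary, so f(z, Phi(z)) is normal and its
    norm is its largest eigenvalue modulus.  For |z| < 1 the eigenvalues w of
    Phi(z) satisfy |w| < 1: an eigenvalue on the circle would put a whole line
    C x {w} into V, and dividing p by the corresponding factor would contradict
    minimality.  Hence the eigenvalues f(z, w) of f(z, Phi(z)) are bounded by
    the supremum of |f| over V0 when |z| < 1, and a determinant estimate carries
    this bound over to |z| = 1.  The maximum principle applied to the rational
    functions y^* f(z, Phi(z)) x then gives ||f(z, Phi(z))|| <= sup |f| on the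
    disk, from which the inequalities follow.  The same eigenvalue estimate with
    bound 0 extends F = f from V0 to the closed bidisk. *)

Require Import Defs.
From HB Require Import structures.
From mathcomp Require Import all_boot all_order all_algebra.
From mathcomp Require Import complex polyXY sesquilinear spectral.
From mathcomp Require Import all_classical all_reals all_analysis.
From mathcomp Require Import ring.

Set Implicit Arguments.
Unset Strict Implicit.
Unset Printing Implicit Defensive.

Import Order.TTheory GRing.Theory Num.Theory numFieldNormedType.Exports.

Local Open Scope classical_set_scope.
Local Open Scope complex_scope.
Local Open Scope ring_scope.

(** * Rational functions on the closed disk *)

Section ComplexModulus.
Variable R : realType.
Implicit Types (x y z : R[i]) (p : {poly R[i]}).

Lemma normr_normc z : `|z| = (normc z)%:C.
Proof. by rewrite normc_def; case: z. Qed.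

Lemma normc_ge0 z : 0 <= normc z.
Proof. by rewrite -ler0c -normr_normc. Qed.

Lemma normc0_eq0 z : (normc z == 0) = (z == 0).
Proof. by rewrite -[z == 0]normr_eq0 normr_normc eq_complex /= eqxx andbT. Qed.

Lemma normc_gt0 z : (0 < normc z) = (z != 0).
Proof. by rewrite lt_neqAle normc_ge0 andbT eq_sym normc0_eq0. Qed.

Lemma normc_mul x y : normc (x * y) = normc x * normc y.
Proof. exact: ComplexField.Normc.normcM. Qed.

Lemma normc_inv x : normc x^-1 = (normc x)^-1.
Proof. exact: ComplexField.Normc.normcV. Qed.

Lemma normc_exp x k : normc (x ^+ k) = normc x ^+ k.
Proof. by apply: complexI; rewrite rmorphXn/= -!normr_normc normrX. Qed.

Lemma normc_real (r : R) : normc r%:C = `|r|.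
Proof. by rewrite /= expr0n/= addr0 sqrtr_sqr. Qed.

Lemma normc_opp x : normc (- x) = normc x.
Proof. by apply: complexI; rewrite -!normr_normc normrN. Qed.

Lemma normcB x y : normc (x - y) = normc (y - x).
Proof. by rewrite -opprB normc_opp. Qed.

Lemma le_normc_add x y : normc (x + y) <= normc x + normc y.
Proof. by rewrite -lecR rmorphD/= -!normr_normc ler_normD. Qed.

Lemma normc_subl x y : normc x - normc y <= normc (x - y).
Proof. by rewrite -lecR rmorphB/= -!normr_normc lerB_dist. Qed.

Lemma normc_dist x y : `|normc x - normc y| <= normc (x - y).
Proof.
rewrite ler_norml normc_subl andbT lerNl opprB normcB; exact: normc_subl.
Qed.

Lemma normc_prod (I : Type) (r : seq I) (F : I -> R[i]) :
  normc (\prod_(i <- r) F i) = \prod_(i <- r) normc (F i).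
Proof.
apply: (big_morph _ normc_mul); exact: ComplexField.Normc.normc1.
Qed.

Lemma le_normc_sum (I : Type) (r : seq I) (P : pred I) (F : I -> R[i]) :
  normc (\sum_(i <- r | P i) F i) <= \sum_(i <- r | P i) normc (F i).
Proof.
elim/big_rec2: _ => [|i y x _ h]; first by rewrite ComplexField.Normc.normc0.
by rewrite (le_trans (le_normc_add _ _))// lerD2l.
Qed.

Lemma normc_conj_mul z : z * z^* = (normc z ^+ 2)%:C.
Proof. by rewrite -sqr_normc normr_normc -rmorphXn. Qed.

Lemma continuous_normc : continuous (fun z : R[i]^o => normc z).
Proof.
move=> z; apply/(@cvgrPdist_lt R R _ (nbhs (z : R[i]^o))) => e e0.
have e0' : 0 < e%:C by rewrite ltcR.
exists e%:C; first exact: e0'.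
move=> t; rewrite /ball_/= normr_normc ltcR; exact: le_lt_trans (normc_dist _ _).
Qed.

Lemma continuous_real_complex : continuous (fun r : R => (r%:C : R[i]^o)).
Proof.
move=> r; apply/(@cvgrPdist_lt _ (R[i]^o)) => -[e1 e2]; rewrite ltcE/= => /andP[/eqP-> e0].
near=> t.
rewrite -rmorphB/= normr_normc normc_real ltcR.
by near: t; apply: (@cvgr_dist_lt R R _ (nbhs r) _ id r) => //; exact: cvg_id.
Unshelve. all: by end_near. Qed.

Lemma continuous_poly p : continuous (fun z : R[i]^o => (p.[z] : R[i]^o)).
Proof.
elim/poly_ind: p => [|p c ih] z.
  rewrite (_ : (fun _ => _) = cst 0); first exact: cst_continuous.
  by apply/funext => t; rewrite horner0.
rewrite /continuous_at hornerMXaddC.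
rewrite (_ : (fun _ => _) = (fun z : R[i]^o => p.[z] * z + c : R[i]^o)).
  have FF := nbhs_filter z.
  have h := (@cvgD _ (R[i]^o) _ _ FF _ (cst c) _ c (@cvgM R[i] _ _ FF _ id _ z (ih z) cvg_id)
           (@cvg_cst _ _ _ _ FF)). exact: h.
by apply/funext => t; rewrite hornerMXaddC.
Qed.

End ComplexModulus.

(** * Maximum principle for rational functions without poles in the closed disk *)

Section RegularFunctions.
Variable R : realType.
Implicit Types (z : R[i]) (p : {poly R[i]}) (u v : R[i] -> R[i]).

Lemma nbhs_normcP z (P : set R[i]) : nbhs (z : R[i]^o) P ->
  exists2 r : R, 0 < r & forall t, normc (t - z) < r -> P t.
Proof.
case=> -[r1 r2] /=; rewrite ltcE/= => /andP[/eqP-> r0] h; exists r1 => //.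
by move=> t tz; apply: h; rewrite /= normr_normc ltcR normcB.
Qed.

Lemma disk_dense z (r : R) : normc z <= 1 -> 0 < r ->
  exists2 t, normc t < 1 & normc (t - z) < r.
Proof.
(* Radial contraction: [(1 - e) z] is within [e < r] of [z] and has modulus at most [1 - e < 1]. *)
move=> z1 r0; pose e : R := Num.min r 1 / 2.
have r10 : 0 < Num.min r 1 by rewrite lt_min r0 ltr01.
have e0 : 0 < e by rewrite divr_gt0.
have : e < Num.min r 1 by rewrite ltr_pdivrMr// ltr_pMr// ltr1n.
rewrite lt_min => /andP[er e1]; exists ((1 - e)%:C * z).
  rewrite normc_mul normc_real gtr0_norm ?subr_gt0//.
  apply: (@le_lt_trans _ _ (1 - e)); last by rewrite ltrBlDr ltrDl.
  by rewrite ler_piMr// subr_ge0 ltW.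
have -> : (1 - e)%:C * z - z = (- e)%:C * z.
  by rewrite rmorphB rmorphN rmorph1; ring.
by rewrite normc_mul normc_real normrN gtr0_norm// (le_lt_trans _ er)// ler_piMr// ltW.
Qed.

Lemma continuous_normc_frac p q z : q.[z] != 0 ->
  {for z, continuous (fun t : R[i]^o => normc (p.[t] / q.[t]))}.
Proof.
move=> qz.
rewrite (_ : (fun _ => _) = (fun t : R[i]^o => normc p.[t] * (normc q.[t])^-1)); last first.
  by apply/funext => t; rewrite normc_mul normc_inv.
have cp r : {for z, continuous (fun t : R[i]^o => normc r.[t])}.
  exact: continuous_comp (@continuous_poly _ r z) (@continuous_normc _ _).
have FF := nbhs_filter (z : R[i]^o).
have hV := @cvgV _ _ _ FF _ _ _ (cp q).
by apply: (@cvgM _ _ _ FF _ _ _ _ (cp p)); apply: hV; rewrite normc0_eq0.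
Qed.

Definition cdisk : set R[i]^o := [set z | normc z <= 1].

Lemma cdisk_compact : compact cdisk.
Proof.
(* Heine-Borel is only available over R, so the disk is realized as the image of a
   compact subset of R * R. *)
pose ri (x : R * R) : R[i]^o := x.1%:C + 'i%C * x.2%:C.
have ri_cont : continuous ri.
  move=> x.
  have FF := nbhs_filter x.
  have h1 := continuous_comp (@cvg_fst R R (nbhs x.1) (nbhs x.2) (nbhs_filter _))
    (@continuous_real_complex R x.1).
  have h2 := continuous_comp (@cvg_snd R R (nbhs x.1) (nbhs x.2) (nbhs_filter _))
    (@continuous_real_complex R x.2).
  have h3 := @cvgM R[i] _ _ FF (cst 'i%C) _ 'i%C _ (@cvg_cst R[i]^o _ _ _ FF) h2.
  have h := @cvgD _ (R[i]^o) _ _ FF _ _ _ _ h1 h3.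
  exact: h.
pose K := (`[(-1 : R), 1] `*` `[(-1 : R), 1]) `&` [set x | normc (ri x) <= 1].
have -> : cdisk = ri @` K.
  apply/seteqP; split => [z|_ [x [_ /= h] <-]]; last exact: h.
  rewrite /cdisk/= => zn; have riz : ri (complex.Re z, complex.Im z) = z by rewrite [RHS]complexE.
  exists (complex.Re z, complex.Im z) => //; split; last by rewrite /mkset riz.
  split; rewrite /= in_itv/= -ler_norml (le_trans _ zn)// -lecR -normr_normc.
    exact: normc_ge_Re.
  (* The imaginary part is bounded through the real part of the product of [z] and ['i]. *)
  by rewrite -normrN -ReiNIm -[leRHS]mulr1 -(_ : `|'i%C| = 1) -?normrM ?normc_ge_Re// normr_normc/= expr0n/= add0r expr1n sqrtr1.
apply: continuous_compact; first exact: continuous_subspaceT.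
apply: compact_closedI; first by apply: compact_setX; exact: segment_compact.
have cn : continuous (fun x => normc (ri x)).
  by move=> x; exact: continuous_comp (ri_cont x) (@continuous_normc _ _).
by apply: (@closed_comp _ _ _ [set y : R | y <= 1]) => [x _|]; [exact: cn | exact: closed_le].
Qed.

(** Constrained on the closed disk only, so that totalised operations such as [invmx] may take any
    value elsewhere. *)
Definition regular u := exists p q, (forall z, normc z <= 1 -> q.[z] != 0) /\
  (forall z, normc z <= 1 -> u z = p.[z] / q.[z]).

Lemma regular_max u : regular u ->
  exists2 z0, normc z0 <= 1 & forall z, normc z <= 1 -> normc (u z) <= normc (u z0).
Proof.
move=> [p [q [q0 upq]]].
have [] := @compact_EVT_max _ R (fun z : R[i]^o => normc (p.[z] / q.[z])) cdisk.
- by exists (0 : R[i]); rewrite /cdisk /mkset ComplexField.Normc.normc0.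
- exact: cdisk_compact.
- apply: continuous_in_subspaceT => z; rewrite inE => zD.
  exact/continuous_normc_frac/q0.
move=> z0; rewrite inE => z0D h; exists z0 => // z zD.
by rewrite !upq//; apply: h; rewrite inE.
Qed.

(** The modulus attains its maximum. At an interior point with non-zero value, the lowest-order term
    of the local expansion gives a direction in which the modulus grows, unless the function is
    constant. *)
Lemma regular_maximum_principle u (S : R) : regular u ->
  (forall z, normc z = 1 -> normc (u z) <= S) ->
  forall z, normc z <= 1 -> normc (u z) <= S.
Proof.
move=> ru uS; have [z0 z01 z0max] := regular_max ru.
suff h : normc (u z0) <= S by move=> z z1; rewrite (le_trans (z0max _ z1)).
have n1 : normc (1 : R[i]) = 1 by exact: ComplexField.Normc.normc1.
have [/uS//|z0n] := eqVneq (normc z0) 1.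
have {z01 z0n} z0lt : normc z0 < 1 by rewrite lt_neqAle z0n.
have [c0|c0] := eqVneq (u z0) 0.
  by rewrite c0 ComplexField.Normc.normc0 (le_trans _ (uS _ n1))// normc_ge0.
move: ru => [p [q [q0 upq]]].
pose c := u z0; rewrite -/c in z0max c0 *.
pose p1 := p \Po ('X + z0%:P); pose q1 := q \Po ('X + z0%:P).
have p1E t : p1.[t] = p.[t + z0] by rewrite horner_comp !hornerE.
have q1E t : q1.[t] = q.[t + z0] by rewrite horner_comp !hornerE.
have qz0 : q.[z0] != 0 by apply: q0; exact: ltW.
have cE : p.[z0] = c * q.[z0] by rewrite /c upq 1?ltW// divfK.
(* Recentred at [z0], the function is [c + h / q1], so [h] vanishes at 0 to the order of [u - c] at
   [z0]. *)
pose h := p1 - c *: q1.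
have h0 : h.[0] = 0 by rewrite /h !hornerE p1E q1E add0r cE subrr.
(* If [h = 0] then [u] is constant on the disk, and its value can be read at 1, on the circle. *)
have [hz|hn0] := eqVneq h 0.
  suff -> : c = u 1 by exact: uS.
  have /eqP : h.[1 - z0] = 0 by rewrite hz horner0.
  rewrite /h !hornerE p1E q1E subrK subr_eq0 => /eqP E.
  by rewrite upq ?n1// E mulfK// q0 ?n1.
have [k [g]] := multiplicity_XsubC h 0; rewrite hn0 subr0 /= => g0 hE.
have k0 : (0 < k)%N.
  rewrite lt0n; apply/eqP => k0; move: g0; rewrite k0 expr0 mulr1 in hE.
  by rewrite -hE /root h0 eqxx.
rewrite /root in g0.
(* With this choice of l, moving from z0 to z0 + s l multiplies u by 1 + s^k b
   with b -> 1 as s -> 0+, which increases the modulus of u. *)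
pose l := k.-root (c * q.[z0] / g.[0]).
have lE : l ^+ k = c * q.[z0] / g.[0] by rewrite rootCK.
have [r1 r10 hr1] : exists2 r : R, 0 < r & forall t, normc t < r -> normc (t + z0) < 1.
  have /(@continuous_normc R z0) : nbhs (normc z0) [set y : R | y < 1] by exact: lt_nbhsl.
  move=> /nbhs_normcP[r r0 nr]; exists r => // t tr; apply: (nr (t + z0)).
  by rewrite addrK.
pose K := q.[z0] / g.[0].
(* By the choice of [K] the numerator vanishes at 0, so this quotient, the error term [b] below, has
   modulus less than 1 near 0. *)
have [r2 r20 hr2] : exists2 r : R, 0 < r &
    forall t, normc t < r -> normc ((K *: g - q1).[t] / q1.[t]) < 1.
  have C : {for 0, continuous (fun t : R[i]^o => normc ((K *: g - q1).[t] / q1.[t]))}.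
    by apply: continuous_normc_frac; rewrite q1E add0r.
  have /C : nbhs (normc ((K *: g - q1).[0] / q1.[0])) [set y : R | y < 1].
    apply: lt_nbhsl; rewrite !hornerE q1E add0r /K divfK// subrr mul0r.
    by rewrite ComplexField.Normc.normc0.
  move=> /nbhs_normcP[r r0 h2]; exists r => // t tr; apply: h2.
  by rewrite subr0.
(* Chosen so that [s l] has modulus below both radii; the [+ 1] keeps the denominator positive. *)
pose s : R := Num.min r1 r2 / 2 / (normc l + 1).
have l1 : 0 < normc l + 1 by rewrite ltr_wpDl ?normc_ge0.
have r0 : 0 < Num.min r1 r2 by rewrite lt_min r10.
have s0 : 0 < s by rewrite /s !divr_gt0.
pose t := s%:C * l.
have tr : normc t < Num.min r1 r2.
  rewrite normc_mul normc_real gtr0_norm// /s mulrAC.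
  rewrite (@le_lt_trans _ _ (Num.min r1 r2 / 2))//; last by rewrite ltr_pdivrMr// ltr_pMr// ltr1n.
  by rewrite ler_pdivrMr// ler_wpM2l ?divr_ge0 ?lerDl ?ltW.
move: tr; rewrite lt_min => /andP[/hr1 t1 /hr2 t2].
have q1t : q1.[t] != 0 by rewrite q1E; apply/q0/ltW.
set b := _ / _ in t2.
have uE : u (t + z0) = c * (1 + (s ^+ k)%:C + (s ^+ k)%:C * b).
  rewrite upq ?ltW// -p1E -q1E; apply: (mulIf q1t); rewrite divfK//.
  have -> : p1.[t] = c * q1.[t] + h.[t] by rewrite /h hornerD hornerN hornerZ addrC subrK.
  rewrite hE hornerM horner_exp ?hornerXsubC ?subr0 ?hornerX exprMn -rmorphXn/= lE /b hornerD hornerN hornerZ /K.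
  by field; rewrite q1t.
have := z0max _ (ltW t1); rewrite uE normc_mul leNgt ltr_pMr ?normc_gt0// => /negP[].
(* Since [|b| < 1], the gain [s ^+ k] exceeds the error [s ^+ k |b|], and the factor has modulus
   above 1. *)
apply: (@lt_le_trans _ _ (normc (1 + (s ^+ k)%:C) - normc ((s ^+ k)%:C * b))).
  have -> : 1 + (s ^+ k)%:C = (1 + s ^+ k)%:C by rewrite rmorphD rmorph1.
  have sk0 : 0 < s ^+ k by exact: exprn_gt0.
  rewrite normc_mul !normc_real !gtr0_norm ?addr_gt0// -addrA ltrDl subr_gt0.
  by rewrite gtr_pMr.
by have := normc_subl (1 + (s ^+ k)%:C) (- ((s ^+ k)%:C * b)); rewrite opprK normc_opp.
Qed.

(** By continuity a violation at a boundary point would persist at nearby points of the open disk,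
    which is dense. *)
Lemma regular_closure u (c : R) : regular u ->
  (forall z, normc z < 1 -> c <= normc (u z)) ->
  forall z, normc z <= 1 -> c <= normc (u z).
Proof.
move=> [p [q [q0 upq]]] cu z z1; rewrite upq// leNgt; apply/negP => uc.
have C := @continuous_normc_frac p q z (q0 _ z1).
have /C : nbhs (normc (p.[z] / q.[z])) [set y : R | y < c] by exact: lt_nbhsl.
move=> /nbhs_normcP[r r0 h].
have [t t1 tz] := disk_dense z1 r0.
have : normc (p.[t] / q.[t]) < c by exact: (h t tz).
by rewrite -(upq _ (ltW t1)) ltNge cu.
Qed.

End RegularFunctions.

(** * Stability of regular functions under algebraic and matrix operations *)

Section RegularAlgebra.
Variable R : realType.
Implicit Types (z : R[i]) (p : {poly R[i]}) (u v : R[i] -> R[i]).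

Lemma regular_ext u v : (forall z, normc z <= 1 -> u z = v z) -> regular v -> regular u.
Proof. by move=> uv [p [q [q0 vE]]]; exists p, q; split=> // z z1; rewrite uv// vE. Qed.

Lemma regular_poly p : regular (fun z => p.[z]).
Proof. by exists p, 1; split=> z _; rewrite hornerC ?oner_eq0// divr1. Qed.

Lemma regular_cst (c : R[i]) : regular (fun=> c).
Proof. by apply: regular_ext (regular_poly c%:P) => z _; rewrite hornerC. Qed.

Lemma regularD u v : regular u -> regular v -> regular (fun z => u z + v z).
Proof.
move=> [p [q [q0 uE]]] [p' [q' [q'0 vE]]].
exists (p * q' + p' * q), (q * q'); split=> z z1; rewrite !hornerE.
  by rewrite mulf_neq0 ?q0 ?q'0.
by rewrite uE// vE//; field; rewrite q0 ?q'0.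
Qed.

Lemma regularM u v : regular u -> regular v -> regular (fun z => u z * v z).
Proof.
move=> [p [q [q0 uE]]] [p' [q' [q'0 vE]]].
exists (p * p'), (q * q'); split=> z z1; rewrite !hornerE.
  by rewrite mulf_neq0 ?q0 ?q'0.
by rewrite uE// vE//; field; rewrite q0 ?q'0.
Qed.

Lemma regularV u : regular u -> (forall z, normc z <= 1 -> u z != 0) ->
  regular (fun z => (u z)^-1).
Proof.
move=> [p [q [q0 uE]]] u0; exists q, p; split=> z z1; last by rewrite uE// invf_div.
by have := u0 z z1; rewrite uE//; apply: contraNneq => ->; rewrite mul0r.
Qed.

Lemma regular_sum (I : Type) (r : seq I) (F : I -> R[i] -> R[i]) :
  (forall i, regular (F i)) -> regular (fun z => \sum_(i <- r) F i z).
Proof.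
move=> rF; elim: r => [|i r ih].
  by apply: regular_ext (regular_cst 0) => z _; rewrite big_nil.
by apply: regular_ext (regularD (rF i) ih) => z _; rewrite big_cons.
Qed.

Lemma regular_prod (I : Type) (r : seq I) (F : I -> R[i] -> R[i]) :
  (forall i, regular (F i)) -> regular (fun z => \prod_(i <- r) F i z).
Proof.
move=> rF; elim: r => [|i r ih].
  by apply: regular_ext (regular_cst 1) => z _; rewrite big_nil.
by apply: regular_ext (regularM (rF i) ih) => z _; rewrite big_cons.
Qed.

Definition mregular a b (M : R[i] -> 'M[R[i]]_(a, b)) :=
  forall i j, regular (fun z => M z i j).

Lemma mregular_ext a b (M N : R[i] -> 'M[R[i]]_(a, b)) :
  (forall z, normc z <= 1 -> M z = N z) -> mregular N -> mregular M.
Proof. by move=> MN rN i j; apply: regular_ext (rN i j) => z z1; rewrite MN. Qed.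

Lemma mregular_cst a b (M : 'M[R[i]]_(a, b)) : mregular (fun=> M).
Proof. by move=> i j; exact: regular_cst. Qed.

Lemma mregularD a b (M N : R[i] -> 'M[R[i]]_(a, b)) :
  mregular M -> mregular N -> mregular (fun z => M z + N z).
Proof.
by move=> rM rN i j; apply: regular_ext (regularD (rM i j) (rN i j)) => z _; rewrite mxE.
Qed.

Lemma mregularZ a b u (M : R[i] -> 'M[R[i]]_(a, b)) :
  regular u -> mregular M -> mregular (fun z => u z *: M z).
Proof.
by move=> ru rM i j; apply: regular_ext (regularM ru (rM i j)) => z _; rewrite mxE.
Qed.

Lemma mregularM a b c (M : R[i] -> 'M[R[i]]_(a, b)) (N : R[i] -> 'M[R[i]]_(b, c)) :
  mregular M -> mregular N -> mregular (fun z => M z *m N z).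
Proof.
move=> rM rN i j.
by apply: regular_ext (regular_sum _ (fun k => regularM (rM i k) (rN k j))) => z _; rewrite mxE.
Qed.

Lemma mregular_sum a b (I : Type) (r : seq I) (F : I -> R[i] -> 'M[R[i]]_(a, b)) :
  (forall i, mregular (F i)) -> mregular (fun z => \sum_(i <- r) F i z).
Proof.
move=> rF i j; apply: regular_ext (regular_sum r (fun k => rF k i j)) => z _.
by rewrite summxE.
Qed.

Lemma mregularX a (M : R[i] -> 'M[R[i]]_a) k :
  mregular M -> mregular (fun z => M z ^+ k).
Proof.
move=> rM; elim: k => [|k ih]; first exact: (mregular_cst 1).
by apply: mregular_ext (mregularM rM ih) => z _; rewrite exprS.
Qed.

Lemma regular_det a (M : R[i] -> 'M[R[i]]_a) : mregular M -> regular (fun z => \det (M z)).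
Proof.
move=> rM; apply: regular_sum => s; apply: regularM; first exact: regular_cst.
by apply: regular_prod => i; exact: rM.
Qed.

(** Cramer's rule: minors are regular, and the determinant is regular without zeros on the closed
    disk. *)
Lemma mregular_inv a (M : R[i] -> 'M[R[i]]_a) :
  mregular M -> (forall z, normc z <= 1 -> M z \in unitmx) ->
  mregular (fun z => invmx (M z)).
Proof.
move=> rM uM.
apply: (@mregular_ext _ _ _ (fun z => (\det (M z))^-1 *: \adj (M z))).
  by move=> z z1; rewrite /invmx uM.
apply: mregularZ.
  by apply: regularV; [exact: regular_det | move=> z /uM; rewrite unitmxE unitfE].
move=> i j.
apply: (@regular_ext _ (fun z => (-1) ^+ (j + i) * \det (row' j (col' i (M z))))).
  by move=> z _; rewrite mxE.
apply: regularM; first exact: regular_cst.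
by apply: regular_det => k l; apply: regular_ext (rM (lift j k) (lift i l)) => z _; rewrite !mxE.
Qed.

Lemma mregular_eval a (Q : 'M[{poly R[i]}]_a) : mregular (mxpoly_eval Q).
Proof. by move=> i j; apply: regular_ext (regular_poly (Q i j)) => z _; rewrite mxE. Qed.

Lemma mregular_scalar a : mregular (fun z => z%:M : 'M[R[i]]_a).
Proof.
move=> i j; apply: (@regular_ext _ (fun z => ('X *+ (i == j)).[z])); last exact: regular_poly.
by move=> z _; rewrite mxE hornerMn hornerX.
Qed.

Lemma mregular_eval2 a f (M : R[i] -> 'M[R[i]]_a) :
  mregular M -> mregular (fun z => mx_eval2 f z%:M (M z)).
Proof.
move=> rM; apply: mregular_sum => i; apply: mregular_sum => j.
apply: mregularZ; first exact: regular_cst.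
by apply: mregularM; apply: mregularX => //; exact: mregular_scalar.
Qed.

End RegularAlgebra.

(** * The transfer function of a unitary realization *)

Section RowGram.
Variable R : realType.
Local Open Scope sesquilinear_scope.

Lemma trmxC_row_mx (a b c : nat) (M : 'M[R[i]]_(a, b)) (N : 'M[R[i]]_(a, c)) :
  (row_mx M N)^t* = col_mx (M^t*) (N^t*).
Proof. by rewrite tr_row_mx map_col_mx. Qed.

Lemma dotmx_gt0 k (v : 'rV[R[i]]_k) : v != 0 -> 0 < (v *m v^t*) 0 0.
Proof. by move=> v0; rewrite -dotmxE dnorm_gt0. Qed.

Lemma dotmx_ge0 k (v : 'rV[R[i]]_k) : 0 <= (v *m v^t*) 0 0.
Proof. by rewrite -dotmxE dnorm_ge0. Qed.

Lemma scale_trmxC a b w (v : 'M[R[i]]_(a, b)) :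
  (w *: v) *m (w *: v)^t* = `|w| ^+ 2 *: (v *m v^t*).
Proof. by rewrite linearZ/= map_mxZ -scalemxAl -scalemxAr scalerA normCK. Qed.

Lemma dotmxZ k w (v : 'rV[R[i]]_k) :
  ((w *: v) *m (w *: v)^t*) 0 0 = `|w| ^+ 2 * (v *m v^t*) 0 0.
Proof. by rewrite scale_trmxC [LHS]mxE. Qed.

End RowGram.

Section Realization.
Local Open Scope sesquilinear_scope.
Variables (R : realType) (m n : nat).
Variables (A : 'M[R[i]]_m) (B : 'M[R[i]]_(m, n)) (C : 'M[R[i]]_(n, m)) (D : 'M[R[i]]_n).
Hypothesis unitaryU : block_mx A B C D \is unitarymx.
Hypothesis eigD : forall a : R[i], normc a = 1 -> ~~ eigenvalue D a.
Implicit Types z w : R[i].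

(** Unitarity of the block matrix enters the section through this invariance of Gram matrices,
    applied to well-chosen rows. *)
Lemma mulmx_unitaryK (a : nat) (M N : 'M[R[i]]_(a, m + n)) :
  (M *m block_mx A B C D) *m (N *m block_mx A B C D)^t* = M *m N^t*.
Proof.
rewrite trmx_mul map_mxM mulmxA -(mulmxA M) (unitarymxP unitaryU).
by rewrite mulmx1.
Qed.

(** Suppose [v = z v D] with [v != 0]. If [|z| = 1], then [z^-1] is a unimodular eigenvalue of [D].
    If [|z| < 1], this contradicts [|v D| <= |v|], as [D] is a block of a unitary matrix. *)
Lemma resolvent_unitmx z : normc z <= 1 -> 1%:M - z *: D \in unitmx.
Proof.
move=> z1; rewrite unitmxE unitfE; apply/negP => /det0P[v v0].
rewrite mulmxBr mulmx1 -scalemxAr => /eqP; rewrite subr_eq0 => /eqP vE.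
have [z1'|zn1] := eqVneq (normc z) 1.
  have zn0 : z != 0 by rewrite -normc_gt0 z1'.
  have := @eigD z^-1; rewrite normc_inv z1' invr1 => /(_ erefl)/negP; apply.
  by apply/eigenvalueP; exists v => //; rewrite {2}vE scalerA mulVf// scale1r.
have {z1 zn1} zlt : `|z| < 1 by rewrite normr_normc ltcR lt_neqAle zn1.
have := mulmx_unitaryK (row_mx 0 v) (row_mx 0 v).
rewrite mul_row_block !mul0mx !add0r !trmxC_row_mx !mul_row_col.
rewrite trmx0 map_mx0 mulmx0 add0r => /matrixP/(_ 0 0); rewrite mxE => vD.
pose a := (v *m v^t*) 0 0; pose b := ((v *m D) *m (v *m D)^t*) 0 0.
have a0 : 0 < a by exact: dotmx_gt0.
have ab : a = `|z| ^+ 2 * b.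
  by have := congr1 (fun x => (x *m x^t*) 0 0) vE; rewrite dotmxZ.
have b0 : 0 < b.
  rewrite lt_neqAle dotmx_ge0 andbT; apply/eqP => b0.
  by move: a0; rewrite ab -b0 mulr0 ltxx.
have le_ba : b <= a by rewrite /a -vD lerDr dotmx_ge0.
have ltab : a < b by rewrite ab gtr_pMl// expr_lt1 ?zlt.
by have := lt_le_trans ltab le_ba; rewrite ltxx.
Qed.

Let X z := B *m invmx (1%:M - z *: D).

Lemma mulmx_resolventK z : normc z <= 1 -> X z *m (1%:M - z *: D) = B.
Proof. by move=> /resolvent_unitmx zu; rewrite mulmxKV. Qed.

(** Feedback form of the realization: [X = B + z X D], so the second block of the product is again
    [X]. *)
Lemma transfer_row z : normc z <= 1 ->
  row_mx 1%:M (z *: X z) *m block_mx A B C D = row_mx (transfer A B C D z) (X z).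
Proof.
move=> z1; rewrite mul_row_block !mul1mx /transfer -!scalemxAl.
by congr row_mx; rewrite -{1}(mulmx_resolventK z1) mulmxBr mulmx1 -scalemxAr subrK.
Qed.

(** Comparing the Gram matrices of both sides of [transfer_row] gives
    [1 + |z|^2 X X^* = Phi Phi^* + X X^*]. *)
Lemma transfer_mul_trmxC z : normc z <= 1 ->
  transfer A B C D z *m (transfer A B C D z)^t* =
  1%:M - (1 - `|z| ^+ 2) *: (X z *m (X z)^t*).
Proof.
move=> z1; have := mulmx_unitaryK (row_mx 1%:M (z *: X z)) (row_mx 1%:M (z *: X z)).
rewrite transfer_row// !trmxC_row_mx !mul_row_col trmx1 map_mx1 mulmx1 scale_trmxC => /eqP.
rewrite eq_sym -subr_eq => /eqP <-.
by rewrite scalerBl scale1r opprB addrA.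
Qed.

Lemma realization_detE z w : (realization_det A B C D).[z, w] =
  \det (block_mx (A - w%:M) (z *: B) C (z *: D - 1%:M)).
Proof.
rewrite -[LHS]/((horner_eval w \o horner_eval z%:P) _) /realization_det -det_map_mx map_block_mx.
congr (\det (block_mx _ _ _ _)); apply/matrixP => i j; rewrite !mxE /= /horner_eval !hornerE//=.
  by rewrite hornerMn hornerC hornerMn hornerX.
by rewrite !(hornerMn, hornerE).
Qed.

(** Schur complement: in a left null vector [(v1, v2)] the second block is [z v1 X], and eliminating
    it leaves [v1 Phi = w v1] with [v1 != 0]. *)
Lemma realization_det0_eigenvalue z w : normc z <= 1 ->
  (realization_det A B C D).[z, w] = 0 -> eigenvalue (transfer A B C D z) w.
Proof.
move=> z1; rewrite realization_detE => /eqP/det0P[v].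
rewrite -[v]hsubmxK; set v1 := lsubmx v; set v2 := rsubmx v => v0.
rewrite mul_row_block -row_mx0 => /eq_row_mx[].
rewrite !mulmxBr mulmx1 mul_mx_scalar -!scalemxAr => E1 /eqP E2.
have v2E : v2 *m (1%:M - z *: D) = z *: (v1 *m B).
  by apply/eqP; rewrite eq_sym -subr_eq0 mulmxBr mulmx1 opprB -scalemxAr.
have {}v2E : v2 = z *: (v1 *m X z).
  by rewrite mulmxA scalemxAl -v2E mulmxK// resolvent_unitmx.
apply/eigenvalueP; exists v1.
  apply/eqP; rewrite -subr_eq0 -E1 /transfer mulmxDr -scalemxAr !mulmxA -/(X z).
  by rewrite v2E -scalemxAl -!mulmxA addrAC.
by apply: contraNneq v0 => v10; rewrite v2E v10 mul0mx scaler0 row_mx0.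
Qed.

(** For a left eigenvector, [|w|^2 |v|^2 = |v|^2 - (1 - |z|^2) |v X|^2]. Equality [|w| = 1] forces
    [v X = 0], hence [v B = 0] and [v A = w v], so [(v, 0)] is a left null vector of the realization
    matrix for every [z']. *)
Lemma transfer_eigenvalue z w : normc z < 1 -> eigenvalue (transfer A B C D z) w ->
  normc w <= 1 /\ (normc w = 1 -> forall z', (realization_det A B C D).[z', w] = 0).
Proof.
move=> z1 /eigenvalueP[v vE v0].
have := transfer_mul_trmxC (ltW z1).
move=> /(congr1 (fun M => (v *m M *m v^t*) 0 0)).
rewrite mulmxA -mulmxA -map_mxM -trmx_mul vE dotmxZ mulmxBr mulmx1 mulmxBl -scalemxAr -scalemxAl.
rewrite mulmxA -(mulmxA (v *m X z)) -map_mxM -trmx_mul [RHS]mxE [X in _ = _ + X]mxE [X in _ = _ - X]mxE.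
have := dotmx_gt0 v0; have := dotmx_ge0 (v *m X z).
set a := (v *m _) 0 0; set b := (v *m X z *m _) 0 0 => b0 a0 E.
have zlt : 0 < 1 - `|z| ^+ 2 by rewrite subr_gt0 expr_lt1// normr_normc ltcR.
split.
  rewrite -lecR -normr_normc -(@expr_le1 _ 2)// -(ler_pM2r a0) mul1r E.
  by rewrite lerBlDr lerDl mulr_ge0// ltW.
move=> w1 z'; move: E; rewrite (normr_normc w) w1 expr1n mul1r => /eqP.
rewrite -subr_eq0 subKr mulf_eq0 gt_eqF//= => /eqP b0'.
have vX : v *m X z = 0.
  by apply/eqP; rewrite -[_ == _]negbK; apply/negP => /dotmx_gt0; rewrite -/b b0' ltxx.
have vB : v *m B = 0 by rewrite -(mulmx_resolventK (ltW z1)) mulmxA vX mul0mx.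
have vA : v *m A = w *: v.
  by rewrite -vE /transfer -/(X z) mulmxDr -scalemxAr mulmxA vX mul0mx scaler0 addr0.
rewrite realization_detE; apply/eqP/det0P; exists (row_mx v 0).
  by apply: contraNneq v0; rewrite -row_mx0 => /eq_row_mx[->].
rewrite mul_row_block !mul0mx !addr0 mulmxBr vA mul_mx_scalar subrr -scalemxAr vB.
by rewrite scaler0 row_mx0.
Qed.

Lemma transfer_unitary z : normc z = 1 -> transfer A B C D z \is unitarymx.
Proof.
move=> z1; apply/unitarymxP; rewrite transfer_mul_trmxC ?z1//.
by rewrite normr_normc z1 expr1n subrr scale0r subr0.
Qed.

Lemma mregular_transfer : mregular (transfer A B C D).
Proof.
apply: mregularD; first exact: mregular_cst.
apply: mregularZ; first by apply: regular_ext (regular_poly 'X) => z _; rewrite hornerX.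
apply: mregularM; last exact: mregular_cst.
apply: mregularM; first exact: mregular_cst.
apply: mregular_inv; last exact: resolvent_unitmx.
apply: (@mregular_ext _ _ _ _ (fun z => 1%:M + (- z) *: D)).
  by move=> z _; rewrite scaleNr.
apply: mregularD; first exact: mregular_cst.
apply: mregularZ; last exact: mregular_cst.
by apply: regular_ext (regular_poly (- 'X)) => z _; rewrite hornerN hornerX.
Qed.

End Realization.

(** * Norms and eigenvalues of matrices *)

Section EuclideanNorm.
Local Open Scope sesquilinear_scope.
Variable R : realType.

Lemma trmxC_mulE k (x y : 'cV[R[i]]_k) : (x^t* *m y) 0 0 = \sum_i (x i 0)^* * y i 0.
Proof. by rewrite mxE; apply: eq_bigr => i _; rewrite !mxE. Qed.

Lemma enorm_ge0 k (x : 'cV[R[i]]_k) : 0 <= enorm x.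
Proof. exact: sqrtr_ge0. Qed.

Lemma enorm_sqrE k (x : 'cV[R[i]]_k) : enorm x ^+ 2 = \sum_i normc (x i 0) ^+ 2.
Proof. by rewrite sqr_sqrtr// sumr_ge0// => i _; rewrite sqr_ge0. Qed.

Lemma enorm_sqr k (x : 'cV[R[i]]_k) : (enorm x ^+ 2)%:C = (x^t* *m x) 0 0.
Proof.
rewrite enorm_sqrE trmxC_mulE rmorph_sum/=; apply: eq_bigr => i _.
by rewrite -normc_conj_mul mulrC.
Qed.

Lemma enorm0 k : enorm (0 : 'cV[R[i]]_k) = 0.
Proof.
apply/eqP; rewrite -sqrf_eq0 enorm_sqrE big1// => i _.
by rewrite mxE ComplexField.Normc.normc0 expr0n.
Qed.

Lemma enormZ k (a : R[i]) (x : 'cV[R[i]]_k) : enorm (a *: x) = normc a * enorm x.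
Proof.
apply/eqP; rewrite -(@eqrXn2 _ 2)// ?enorm_ge0 ?mulr_ge0 ?enorm_ge0 ?normc_ge0//.
rewrite exprMn !enorm_sqrE mulr_sumr; apply/eqP; apply: eq_bigr => i _.
by rewrite mxE normc_mul exprMn.
Qed.

Lemma normc_le_enorm k (x : 'cV[R[i]]_k) i : normc (x i 0) <= enorm x.
Proof.
rewrite -(@ler_pXn2r _ 2)// ?nnegrE ?normc_ge0 ?enorm_ge0// enorm_sqrE (bigD1 i)//= lerDl.
by rewrite sumr_ge0// => j _; rewrite sqr_ge0.
Qed.

Lemma enorm_eq0 k (x : 'cV[R[i]]_k) : enorm x = 0 -> x = 0.
Proof.
move=> x0; apply/matrixP => i j; rewrite ord1 mxE; apply/eqP.
by rewrite -normc0_eq0 eq_le normc_ge0 andbT -x0 normc_le_enorm.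
Qed.

Lemma enorm_le k (x : 'cV[R[i]]_k) (K : R) : 0 <= K ->
  \sum_i normc (x i 0) ^+ 2 <= K ^+ 2 -> enorm x <= K.
Proof. by move=> K0; rewrite -enorm_sqrE ler_pXn2r// nnegrE ?enorm_ge0. Qed.

Lemma enorm_le_sum k (x : 'cV[R[i]]_k) : enorm x <= \sum_i normc (x i 0).
Proof.
have n0 i : 0 <= normc (x i 0) by exact: normc_ge0.
apply: enorm_le; first by rewrite sumr_ge0.
rewrite expr2 mulr_suml ler_sum// => i _.
by rewrite expr2 ler_wpM2l// (bigD1 i)//= lerDl sumr_ge0.
Qed.

Lemma enorm_cauchy_schwarz k (x y : 'cV[R[i]]_k) :
  normc ((x^t* *m y) 0 0) <= enorm x * enorm y.
Proof.
rewrite -(@ler_pXn2r _ 2)// ?nnegrE ?normc_ge0 ?mulr_ge0 ?enorm_ge0//.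
rewrite -lecR exprMn [leRHS]rmorphM/= !enorm_sqr rmorphXn/= -normr_normc.
(* [dotmx] pairs row vectors, hence the passage to adjoints. *)
have : `|dotmx (x^t*) (y^t*)| ^+ 2 <= dotmx (x^t*) (x^t*) * dotmx (y^t*) (y^t*).
  exact: (CauchySchwarz (@dotmx R[i] k) (x^t*) (y^t*)).1.
by rewrite !dotmxE !trmxCK.
Qed.

Lemma enorm_unitary k (P : 'M[R[i]]_k) (x : 'cV[R[i]]_k) :
  P \is unitarymx -> enorm (P *m x) = enorm x.
Proof.
move=> Pu; apply/eqP; rewrite -(@eqrXn2 _ 2)// ?enorm_ge0//; apply/eqP.
suff : (enorm (P *m x) ^+ 2)%:C = (enorm x ^+ 2)%:C by move=> /complexI.
rewrite !enorm_sqr trmx_mul map_mxM -mulmxA (mulmxA _ P).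
by rewrite -(invmx_unitary Pu) mulVmx ?unitarymx_unit// mul1mx.
Qed.

(** Unitary diagonalisation reduces the bound to the diagonal entries, which are eigenvalues. *)
Lemma enorm_normalmx k (M : 'M[R[i]]_k) (S : R) (x : 'cV[R[i]]_k) : 0 <= S ->
  M \is normalmx -> (forall t, eigenvalue M t -> normc t <= S) ->
  enorm (M *m x) <= S * enorm x.
Proof.
move=> S0 /orthomx_spectralP; set P := spectralmx M; set d := spectral_diag M => ME eS.
have Pu : P \is unitarymx by exact: spectral_unitarymx.
have Pi : P \in unitmx by exact: spectral_unit.
have dS i : normc (d 0 i) <= S.
  (* Row [i] of [P] is a left eigenvector for [d 0 i]. *)
  apply/eS/eigenvalueP; exists (delta_mx 0 i *m P); last first.
    rewrite mulmx_free_eq0 ?row_free_unit//; apply/eqP => /matrixP/(_ 0 i)/eqP.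
    by rewrite !mxE !eqxx oner_eq0.
  rewrite {1}ME !mulmxA mulmxK// scalemxAl; congr (_ *m _).
  apply/matrixP => a j; rewrite mul_mx_diag !mxE.
  by case: eqP => [_|]; case: eqP => [->|]; rewrite ?mulr0 ?mul0r// mulr1 mul1r.
rewrite ME -!mulmxA invmx_unitary// enorm_unitary ?trmxC_unitary//.
rewrite -(enorm_unitary x Pu); set y := P *m x.
apply: enorm_le; first by rewrite mulr_ge0 ?enorm_ge0.
rewrite exprMn enorm_sqrE mulr_sumr ler_sum// => i _.
rewrite mul_diag_mx mxE normc_mul exprMn ler_wpM2r ?sqr_ge0//.
by rewrite ler_pXn2r// ?nnegrE ?normc_ge0.
Qed.

End EuclideanNorm.

Section OperatorNorm.
Variables (R : realType) (k : nat).
Implicit Types (M : 'M[R[i]]_k) (x : 'cV[R[i]]_k).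

Lemma enorm_mulmx_sum M x :
  enorm (M *m x) <= (\sum_i \sum_j normc (M i j)) * enorm x.
Proof.
rewrite (le_trans (enorm_le_sum _))// mulr_suml ler_sum// => i _.
rewrite mxE (le_trans (le_normc_sum _ _ _))// mulr_suml ler_sum// => j _.
by rewrite normc_mul ler_wpM2l ?normc_ge0// normc_le_enorm.
Qed.

Let ball_im M := [set enorm (M *m v) | v in [set v : 'cV[R[i]]_k | enorm v <= 1]].

Let ball_im_ub M (K : R) : 0 <= K -> (forall x, enorm (M *m x) <= K * enorm x) ->
  ubound (ball_im M) K.
Proof. by move=> K0 MK _ [x /= x1 <-]; rewrite (le_trans (MK x))// ler_piMr. Qed.

Lemma opnorm_le M (K : R) : 0 <= K -> (forall x, enorm (M *m x) <= K * enorm x) ->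
  opnorm M <= K.
Proof.
move=> K0 MK; apply: ge_sup; last exact: ball_im_ub.
by exists (enorm (M *m 0)), 0 => //=; rewrite enorm0.
Qed.

(** Guards against the default value 0 of [sup] on unbounded sets. *)
Lemma opnorm_has_ub M : has_ubound (ball_im M).
Proof.
exists (\sum_i \sum_j normc (M i j)); apply: ball_im_ub; last exact: enorm_mulmx_sum.
by do 2!(apply: sumr_ge0 => ? _); exact: normc_ge0.
Qed.

Lemma opnorm_ge0 M : 0 <= opnorm M.
Proof.
apply: ub_le_sup; first exact: opnorm_has_ub.
by exists 0 => /=; rewrite ?mulmx0 enorm0.
Qed.

Lemma enorm_mulmx M x : enorm (M *m x) <= opnorm M * enorm x.
Proof.
have [/enorm_eq0 ->|x0] := eqVneq (enorm x) 0; first by rewrite mulmx0 !enorm0 mulr0.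
have xgt0 : 0 < enorm x by rewrite lt_neqAle eq_sym x0 enorm_ge0.
rewrite -ler_pdivrMr//; apply: ub_le_sup; first exact: opnorm_has_ub.
have nV : normc (enorm x)^-1%:C = (enorm x)^-1 by rewrite normc_real gtr0_norm ?invr_gt0.
exists ((enorm x)^-1%:C *: x) => /=; last by rewrite -scalemxAr enormZ nV mulrC.
by rewrite enormZ nV mulVf.
Qed.

Lemma opnorm_le_sum M : opnorm M <= \sum_i \sum_j normc (M i j).
Proof.
apply: opnorm_le; last exact: enorm_mulmx_sum.
by do 2!(apply: sumr_ge0 => ? _); exact: normc_ge0.
Qed.

End OperatorNorm.

(** * Spectral mapping, and eigenvalue and norm bounds for regular matrix functions *)

Section RegularMatrices.
Local Open Scope sesquilinear_scope.
Variable R : realType.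

(** Split [g - t] into linear factors: its value at [W] is singular, so some factor [W - w] is
    singular. *)
Lemma eigenvalue_horner_mx k (W : 'M[R[i]]_k.+1) (g : {poly R[i]}) t :
  eigenvalue (horner_mx W g) t -> exists2 w, eigenvalue W w & g.[w] = t.
Proof.
rewrite eigenvalue_root_char; have [r rE] := closed_field_poly_normal (g - t%:P).
have [g0|g0] := eqVneq (g - t%:P) 0.
  (* When [g] is the constant [t], any eigenvalue of [W] will do, and one exists because the size is
     positive. *)
  move=> _; have [w Ww] := eigenvalue_closed W (ltn0Sn k); exists w => //.
  by apply/eqP; rewrite -subr_eq0 -[X in _ - X](hornerC t w) -hornerN -hornerD g0 horner0.
rewrite -eigenvalue_root_char => /eigenvalueP[v vE v0].
have /eqP : \det (horner_mx W (g - t%:P)) = 0.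
  apply/eqP/det0P; exists v => //.
  by rewrite rmorphB/= horner_mx_C mulmxBr vE mul_mx_scalar subrr.
rewrite {1}rE horner_mxZ detZ mulf_eq0 expf_eq0/= lead_coef_eq0 (negPf g0)/=.
rewrite rmorph_prod (big_morph _ (@det_mulmx _ _) (det1 _ _)) prodf_seq_eq0.
move=> /hasP[w wr /=]; rewrite rmorphB/= horner_mx_X horner_mx_C => /det0P[u u0 uE].
exists w.
  apply/eigenvalueP; exists u => //; apply/eqP; rewrite -subr_eq0.
  by rewrite -mul_mx_scalar -mulmxBr uE.
apply/eqP; rewrite -subr_eq0 -[X in _ - X](hornerC t w) -hornerN -hornerD rE hornerZ.
by move: wr; rewrite -root_prod_XsubC => /rootP ->; rewrite mulr0.
Qed.

(** The determinant is the product of the [k] factors [t - s] over the eigenvalues [s], each of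
    modulus at least [|t| - S]. *)
Lemma det_scalar_sub_ge k (M : 'M[R[i]]_k) (S : R) t :
  (forall s, eigenvalue M s -> normc s <= S) -> S <= normc t ->
  (normc t - S) ^+ k <= normc (\det (t%:M - M)).
Proof.
move=> MS St.
have -> : \det (t%:M - M) = (char_poly M).[t].
  rewrite -[RHS]/(horner_eval t _) /char_poly -det_map_mx; congr (\det _).
  by apply/matrixP => i j; rewrite !mxE /= /horner_eval hornerD hornerN hornerMn hornerX hornerC.
have [r rE] := closed_field_poly_normal (char_poly M).
have := size_char_poly M; rewrite {1}rE size_scale ?lead_coef_eq0 ?monic_neq0 ?char_poly_monic//.
rewrite size_prod_XsubC => -[rk].
have rS s : s \in r -> normc s <= S.
  move=> sr; apply: MS; rewrite eigenvalue_root_char rE rootZ ?root_prod_XsubC//.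
  by rewrite lead_coef_eq0 monic_neq0 ?char_poly_monic.
rewrite rE (monicP (char_poly_monic M)) scale1r horner_prod normc_prod -rk.
elim: r rS {rE rk} => [|s r ih] rS; first by rewrite big_nil expr0.
rewrite big_cons exprS ler_pM ?exprn_ge0 ?subr_ge0//.
  rewrite hornerXsubC (le_trans _ (normc_subl _ _))// lerB// rS//.
  by rewrite mem_head.
by apply: ih => s' s'r; rewrite rS// in_cons s'r orbT.
Qed.

(* No continuity of eigenvalues is needed: |det (t - M z)| >= (|t| - S)^k holds on
   the open disk, hence on the closed one, and excludes eigenvalues with |t| > S. *)
Lemma regular_eigenvalue_le k (M : R[i] -> 'M[R[i]]_k) (S : R) : mregular M ->
  (forall z s, normc z < 1 -> eigenvalue (M z) s -> normc s <= S) ->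
  forall z s, normc z <= 1 -> eigenvalue (M z) s -> normc s <= S.
Proof.
move=> rM MS z t z1 Mt; rewrite leNgt; apply/negP => St.
have ru : regular (fun z => \det (t%:M - M z)).
  apply: regular_det; apply: (@mregular_ext _ _ _ _ (fun z => t%:M + (-1) *: M z)).
    by move=> ? _; rewrite scaleN1r.
  by apply: mregularD; [exact: mregular_cst | apply: mregularZ => //; exact: regular_cst].
have := regular_closure ru (fun z z1 => det_scalar_sub_ge (MS z ^~ z1) (ltW St)) z1.
have -> : \det (t%:M - M z) = 0.
  move/eigenvalueP: Mt => [v vE v0]; apply/eqP/det0P; exists v => //.
  by rewrite mulmxBr vE mul_mx_scalar subrr.
by rewrite ComplexField.Normc.normc0 leNgt exprn_gt0// subr_gt0.
Qed.

Lemma enorm_maximum_principle k (M : R[i] -> 'M[R[i]]_k) (S : R) : mregular M -> 0 <= S ->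
  (forall z x, normc z = 1 -> enorm (M z *m x) <= S * enorm x) ->
  forall z x, normc z <= 1 -> enorm (M z *m x) <= S * enorm x.
Proof.
(* Apply the scalar maximum principle to y^* M(t) x, with y := M z x fixed. *)
move=> rM S0 MS z x z1; set y := M z *m x.
have [->|y0] := eqVneq (enorm y) 0; first by rewrite mulr_ge0 ?enorm_ge0.
have ygt0 : 0 < enorm y by rewrite lt_neqAle eq_sym y0 enorm_ge0.
rewrite -(ler_pM2l ygt0) -expr2.
have -> : enorm y ^+ 2 = normc ((y^t* *m (M z *m x)) 0 0).
  by rewrite -enorm_sqr normc_real ger0_norm// sqr_ge0.
have ru : regular (fun z => (y^t* *m (M z *m x)) 0 0).
  by apply: mregularM; [|apply: mregularM => //]; exact: mregular_cst.
apply: (regular_maximum_principle ru _ z1) => t t1.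
by rewrite (le_trans (enorm_cauchy_schwarz _ _))// ler_wpM2l ?enorm_ge0// MS.
Qed.

End RegularMatrices.

(** * Polynomials in a matrix and distinguished varieties *)

Section PolynomialCalculus.
Local Open Scope sesquilinear_scope.
Variables (R : realType) (k : nat).
Implicit Types (W : 'M[R[i]]_k.+1) (g : {poly R[i]}) (f : {poly {poly R[i]}}).

(** As [z%:M] is central, freezing [z] reduces the two-variable calculus to the one-variable one. *)
Lemma mx_eval2_horner f z W : mx_eval2 f z%:M W = horner_mx W f.[z%:P].
Proof.
rewrite horner_coef rmorph_sum/=; apply: eq_bigr => i _.
have zi : z%:M ^+ i = (z ^+ i)%:M :> 'M[R[i]]_k.+1 by rewrite rmorphXn.
rewrite rmorphM rmorphXn/= horner_mx_C zi -[X in horner_mx W X]coefK poly_def.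
rewrite rmorph_sum/= mulr_suml; apply: eq_bigr => j _.
by rewrite horner_mxZ [horner_mx W 'X^j]rmorphXn/= horner_mx_X -scalerAl -scalar_mxC.
Qed.

Lemma horner_mx_eigenrow W g w (v : 'rV_k.+1) :
  v *m W = w *: v -> v *m horner_mx W g = g.[w] *: v.
Proof.
move=> vW; elim/poly_ind: g => [|g c ih]; first by rewrite rmorph0 horner0 mulmx0 scale0r.
rewrite rmorphD rmorphM/= horner_mx_X horner_mx_C mulmxDr mulmxA ih -scalemxAl vW.
by rewrite mul_mx_scalar scalerA -scalerDl hornerMXaddC.
Qed.

Lemma horner_mx_eigencol W g w (v : 'cV_k.+1) :
  W *m v = w *: v -> horner_mx W g *m v = g.[w] *: v.
Proof.
move=> Wv; elim/poly_ind: g => [|g c ih]; first by rewrite rmorph0 horner0 mul0mx scale0r.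
rewrite rmorphD rmorphM/= horner_mx_X horner_mx_C mulmxDl -mulmxA Wv -scalemxAr ih.
by rewrite mul_scalar_mx scalerA -scalerDl hornerMXaddC mulrC.
Qed.

(** The adjoint of [W] is its inverse, so it commutes with [g(W)]; taking adjoints, [g(W)^*]
    commutes with [W], hence with [g(W)]. *)
Lemma horner_mx_unitary_normal W g : W \is unitarymx -> horner_mx W g \is normalmx.
Proof.
move=> Wu; have WV := invmx_unitary Wu.
have WW : comm_mx (W^t*) W by rewrite -WV /comm_mx mulVmx ?mulmxV ?unitarymx_unit.
have /(congr1 (fun X => X^t*)) := comm_mx_horner g WW.
rewrite !trmx_mul !map_mxM trmxCK => cMW.
by apply/normalmxP; rewrite (comm_mx_horner g cMW).
Qed.

(** This uniform bound makes the supremum in [sup_on] a genuine one. *)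
Lemma normc_horner2_le f z w : normc z <= 1 -> normc w <= 1 ->
  normc f.[z, w] <= \sum_(i < size f) \sum_(j < size f`_i) normc f`_i`_j.
Proof.
move=> z1 w1; rewrite (horner_coef f) horner_sum (le_trans (le_normc_sum _ _ _))//.
have le1 x (y : R[i]) a : normc y <= 1 -> normc (x * y ^+ a) <= normc x.
  move=> y1; rewrite normc_mul normc_exp ler_piMr ?normc_ge0//.
  by rewrite exprn_ile1 ?normc_ge0.
apply: ler_sum => i _; rewrite hornerM horner_exp hornerC (le_trans (le1 _ _ _ z1))//.
rewrite horner_coef (le_trans (le_normc_sum _ _ _))//.
by apply: ler_sum => j _; exact: le1.
Qed.

(** Every entry attains its maximum modulus on the closed disk; this makes the supremum in
    [bound_const] finite. *)
Lemma mregular_opnorm_bounded (M : R[i] -> 'M[R[i]]_k) : mregular M ->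
  exists K, forall z, normc z <= 1 -> opnorm (M z) <= K.
Proof.
move=> rM.
have /choice[b bP] (ij : 'I_k * 'I_k) :
    exists b : R, forall z, normc z <= 1 -> normc (M z ij.1 ij.2) <= b.
  have [z0 _ h] := regular_max (rM ij.1 ij.2).
  by exists (normc (M z0 ij.1 ij.2)).
exists (\sum_i \sum_j b (i, j)) => z z1; rewrite (le_trans (opnorm_le_sum _))//.
by apply: ler_sum => i _; apply: ler_sum => j _; exact: (bP (i, j)).
Qed.

End PolynomialCalculus.

(** * Consequences of the boundary condition and of minimal degree *)

Section DistinguishedVariety.
Variable R : realType.
Implicit Types (p q : {poly {poly R[i]}}).

(** If [p] did not involve [w], the variety would contain a vertical disk over some [z] with
    [|z| < 1], and its closure would reach the boundary point [(z, 1)] off the torus. *)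
Lemma distinguished_degw_neq0 p :
  distinguished_variety (zeroset p `&` @bidisk R) -> degw p != 0%N.
Proof.
move=> [[[z w] [pz [/= z1 w1]]] _ bd]; apply/eqP => dw.
have ew w' : p.[z, w'] = 0.
  have : (size p.[z%:P] <= 1)%N.
    by rewrite (leq_trans (max_size_evalC _ _))//; move: dw; rewrite /degw; case: sizeY => [|[]].
  by move=> /size1_polyC E; move: pz; rewrite /zeroset/= E !hornerC.
have cl : closure2 (zeroset p `&` @bidisk R) (z, 1).
  move=> U [[U1 U2] /= [nz n1] sU].
  have [r r0 hr] := nbhs_normcP n1.
  have n1' : normc (1 : R[i]) <= 1 by rewrite (ComplexField.Normc.normc1 R).
  have [t t1 tr] := disk_dense n1' r0.
  exists (z, t); split; first by split; [exact: ew | split; [exact: z1 | exact: t1]].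
  apply: sU; split; last exact: hr.
  have [r' r'0 hr'] := nbhs_normcP nz.
  by apply: hr'; rewrite /= subrr ComplexField.Normc.normc0.
have : (closure2 (zeroset p `&` @bidisk R) `&` boundary2 (@bidisk R)) (z, 1).
  split=> //; split; first by apply: closure_subset cl => x [].
  by move=> /interior_subset[_]; rewrite [(_, _).2]/= (ComplexField.Normc.normc1 R) ltxx.
by rewrite bd => -[_ [/= zn _]]; rewrite zn ltxx in z1.
Qed.

(** Otherwise the factor vanishing on that horizontal line divides [p]. It has no zero in the
    bidisk, so the quotient has the same zeros there and a smaller degree in [w]. *)
Lemma minimal_degree_horizontal p n m w : minimal_degree p n m -> degw p != 0%N ->
  normc w = 1 -> ~ (forall z, p.[z, w] = 0).
Proof.
move=> [_ dm minp] dw0 w1 pw.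
have p0 : p != 0.
  by apply: contraNneq dw0 => ->; rewrite /degw sizeYE rmorph0 size_poly0.
(* After the swap, the value at the constant [w] is a polynomial in [z] that vanishes everywhere,
   hence is 0. *)
have /factor_theorem[q qE] : root (swapXY p) w%:P.
  apply/rootP/eqP; rewrite -[_ == _]negbK; apply/negP => /closed_nonrootP[z].
  by rewrite /root horner2_swapXY pw eqxx.
have q0 : q != 0.
  by apply: contraNneq p0 => q0; rewrite -swapXY_eq0 qE q0 mul0r.
have pE : p = swapXY q * ('Y - w%:P%:P).
  by rewrite -[p]swapXYK qE rmorphM rmorphB/= swapXY_X swapXY_polyC map_polyC.
have [] := minp (swapXY q).
  apply/seteqP; split => -[z w'] [/= qz [z1 w'1]]; split => //; move: qz; rewrite /zeroset /= pE.
    by rewrite !hornerM => ->; rewrite mul0r.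
  rewrite !(hornerM, hornerD, hornerN, hornerC, hornerX) => /eqP; rewrite mulf_eq0 => /orP[/eqP//|].
  by rewrite subr_eq0 => /eqP w'E; move: w'1; rewrite /= w'E w1 ltxx.
move=> _; rewrite -dm /degw !sizeYE swapXYK qE size_Mmonic ?monicXsubC// size_XsubC addn2/=.
by rewrite leqNgt prednK ?lt0n ?size_poly_eq0// leqnn.
Qed.

End DistinguishedVariety.

(** * The extension operator *)

Section Extension.
Variables (R : realType) (n k : nat) (p : {poly {poly R[i]}}).
Local Notation m := k.+1.
Variables (A : 'M[R[i]]_m) (B : 'M[R[i]]_(m, n)) (C : 'M[R[i]]_(n, m)) (D : 'M[R[i]]_n).
Variable Q : 'M[{poly R[i]}]_m.
Hypothesis unitaryU : block_mx A B C D \is unitarymx.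
Hypothesis eigD : forall a : R[i], normc a = 1 -> ~~ eigenvalue D a.
Let Phi := transfer A B C D.
Let V0 := zeroset p `&` @bidisk R.
Hypothesis eigV : forall z w, normc z <= 1 -> p.[z, w] = 0 -> eigenvalue (Phi z) w.
Hypothesis eigV0 : forall z w, normc z < 1 -> eigenvalue (Phi z) w -> V0 (z, w).
Hypothesis V0_neq0 : V0 !=set0.
Hypothesis Qeig : forall z w, V0 (z, w) -> Phi z *m Qvec Q z w = w *: Qvec Q z w.
Hypothesis Qinv : forall z, normc z <= 1 -> mxpoly_eval Q z \in unitmx.
Variable f : {poly {poly R[i]}}.

Let F := extension Q Phi f.
Let supf := sup_on V0 f.
Let M z := mx_eval2 f z%:M (Phi z).

Lemma normc_le_sup_on x : V0 x -> normc f.[x.1, x.2] <= supf.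
Proof.
move=> V0x; apply: ub_le_sup; last by exists x.
exists (\sum_(i < size f) \sum_(j < size f`_i) normc f`_i`_j) => _ [y [_ [y1 y2]] <-].
by apply: normc_horner2_le; exact: ltW.
Qed.

Lemma sup_on_ge0 : 0 <= supf.
Proof. by case: V0_neq0 => x /normc_le_sup_on; exact/le_trans/normc_ge0. Qed.

(** [Qvec] is an eigenvector, so the matrix [f(z, Phi(z))] acts on it as [f(z, w)]; then [Q(z)^-1]
    restores [(1, w, ...)], whose first entry is 1. *)
Lemma extension_eqV0 z w : V0 (z, w) -> F z w = f.[z, w].
Proof.
move=> zw; have z1 : normc z < 1 by case: zw => _ [].
rewrite /F /extension mx_eval2_horner -mulmxA (horner_mx_eigencol _ (Qeig zw)).
rewrite -scalemxAr mxE /Qvec -!mulmxA mulKmx ?Qinv 1?ltW//.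
rewrite mxE big_ord_recl big1 => [|i _]; rewrite !mxE/= ?mul0r//.
by rewrite expr0 mulr1 addr0 mulr1.
Qed.

Lemma enorm_eval2_le z x : normc z <= 1 -> enorm (M z *m x) <= supf * enorm x.
Proof.
have rPhi : mregular Phi by exact: mregular_transfer.
have rM : mregular M by exact: mregular_eval2.
(* Spectral mapping: [s] is [f(t, w)] for an eigenvalue [w] of [Phi t], and [(t, w)] lies in
   [V0]. *)
have eM t s : normc t < 1 -> eigenvalue (M t) s -> normc s <= supf.
  move=> t1; rewrite /M mx_eval2_horner => /eigenvalue_horner_mx[w /(eigV0 t1) tw <-].
  exact: normc_le_sup_on tw.
(* It remains to treat the unit circle, where [M z] is normal and inherits the eigenvalue bound [eM]
   from the open disk. *)
move: z x; apply: (enorm_maximum_principle rM sup_on_ge0) => z x z1.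
apply: (enorm_normalmx _ sup_on_ge0).
  by rewrite /M mx_eval2_horner horner_mx_unitary_normal// transfer_unitary.
by move=> t; apply: (regular_eigenvalue_le rM eM); rewrite z1.
Qed.

Let r z := \row_(j < m) (val j == 0%N)%:R *m invmx (mxpoly_eval Q z) *m M z.

(** For fixed [z], the difference of [F] and [f] as a polynomial in [w], which can then be evaluated
    at the matrix [Phi z]. *)
Let g z : {poly R[i]} :=
  \sum_i r z 0 i *: (\sum_j (Q i j).[z] *: 'X^j) - f.[z%:P].

Let gE z w : (g z).[w] = F z w - f.[z, w].
Proof.
rewrite /g hornerD hornerN horner_sum; congr (_ - _).
rewrite /F /extension -/(M z) -/(r z) mxE; apply: eq_bigr => i _.
rewrite hornerZ horner_sum [Qvec _ _ _ _ _]mxE; congr (_ * _); apply: eq_bigr => j _.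
by rewrite hornerZ hornerXn [mxpoly_eval _ _ _ _]mxE [(\col_j _) _ _]mxE.
Qed.

(** The difference [F - f] at [(z, w)] is an eigenvalue of [G z]. On the open disk all eigenvalues
    of [G] are 0, and the bound 0 passes to the closed disk. *)
Lemma extension_eq z w : normc z <= 1 -> p.[z, w] = 0 -> F z w = f.[z, w].
Proof.
move=> z1 /(eigV z1) ew.
have rPhi : mregular Phi by exact: mregular_transfer.
have rM : mregular M by exact: mregular_eval2.
have rr : mregular r.
  apply: mregularM => //; apply: mregularM; first exact: mregular_cst.
  by apply: mregular_inv => //; exact: mregular_eval.
pose G z := horner_mx (Phi z) (g z).
have rG : mregular G.
  (* The coefficients of [g z] vary with [z] too, so regularity is read off this expansion in powers
     of [Phi z]. *)
  apply: (@mregular_ext _ _ _ _ (fun z => \sum_i r z 0 i *: (\sum_j (Q i j).[z] *: Phi z ^+ j)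
      + (-1) *: M z)) => [t _|].
    rewrite /G rmorphB/= -mx_eval2_horner scaleN1r rmorph_sum/=; congr (_ - _).
    apply: eq_bigr => i _; rewrite horner_mxZ rmorph_sum/=; congr (_ *: _).
    by apply: eq_bigr => j _; rewrite horner_mxZ rmorphXn/= horner_mx_X.
  apply: mregularD; last by apply: mregularZ => //; exact: regular_cst.
  apply: mregular_sum => i; apply: mregularZ; first exact: rr.
  apply: mregular_sum => j; apply: mregularZ; first exact: regular_poly.
  exact: mregularX.
have eG t s : normc t < 1 -> eigenvalue (G t) s -> normc s <= 0.
  move=> t1 /eigenvalue_horner_mx[u /(eigV0 t1) tu <-].
  by rewrite gE extension_eqV0// subrr ComplexField.Normc.normc0.
have : eigenvalue (G z) (g z).[w].
  case/eigenvalueP: ew => v vw v0; apply/eigenvalueP; exists v => //.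
  exact: horner_mx_eigenrow.
move=> /(regular_eigenvalue_le rG eG z1).
by rewrite gE le_eqVlt ltNge normc_ge0 orbF normc0_eq0 subr_eq0 => /eqP.
Qed.

(** [F] is the first entry of [Q^-1 M Qvec], and an entry is at most the length of its vector. *)
Lemma extension_bound z w : normc z <= 1 ->
  normc (F z w) <= opnorm (invmx (mxpoly_eval Q z)) * enorm (Qvec Q z w) * supf.
Proof.
move=> z1; have -> : F z w = (invmx (mxpoly_eval Q z) *m (M z *m Qvec Q z w)) 0 0.
  rewrite /F /extension -!mulmxA mxE big_ord_recl big1 => [|i _]; rewrite !mxE/= ?mul0r//.
  by rewrite mul1r addr0.
rewrite (le_trans (normc_le_enorm _ _))// (le_trans (enorm_mulmx _ _))//.
by rewrite -mulrA ler_wpM2l ?opnorm_ge0// mulrC enorm_eval2_le.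
Qed.

(** The vector [(1, w, ...)] has [m] entries of modulus at most 1. *)
Lemma enorm_Qvec_le z w : normc w <= 1 ->
  enorm (Qvec Q z w) <= Num.sqrt m%:R * opnorm (mxpoly_eval Q z).
Proof.
move=> w1; rewrite (le_trans (enorm_mulmx _ _))// mulrC ler_wpM2r ?opnorm_ge0//.
apply: enorm_le => //; rewrite sqr_sqrtr//.
rewrite -[m in leRHS]card_ord -sum1_card natr_sum ler_sum// => i _.
by rewrite mxE normc_exp -exprM exprn_ile1 ?normc_ge0.
Qed.

Lemma opnorm_le_bound_const z : normc z < 1 ->
  Num.sqrt m%:R * (opnorm (invmx (mxpoly_eval Q z)) * opnorm (mxpoly_eval Q z)) <= bound_const Q.
Proof.
move=> z1; rewrite ler_wpM2l ?sqrtr_ge0//; apply: ub_le_sup; last by exists z.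
have rQ := mregular_eval Q.
have [K1 hK1] := mregular_opnorm_bounded (mregular_inv rQ Qinv).
have [K2 hK2] := mregular_opnorm_bounded rQ.
exists (K1 * K2) => _ [t /ltW t1 <-].
by apply: ler_pM; [exact: opnorm_ge0 | exact: opnorm_ge0 | exact: hK1 | exact: hK2].
Qed.

End Extension.

Theorem theorem2p20 (R : realType) (n m : nat) (p : {poly {poly R[i]}})
  (A : 'M[R[i]]_m) (B : 'M[R[i]]_(m, n)) (C : 'M[R[i]]_(n, m)) (D : 'M[R[i]]_n)
  (Q : 'M[{poly R[i]}]_m)
  (hV : distinguished_variety (zeroset p `&` @bidisk R))
  (hmin : minimal_degree p n m)
  (hsmooth : no_torus_singularity p)
  (hU : block_mx A B C D \is unitarymx)
  (hQdeg : forall i j : 'I_m, (size (Q i j) <= n.+1)%N)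
  (hD : forall a : R[i], normc a = 1 -> ~~ eigenvalue D a)
  (hp : exists c : R[i], p = c%:P%:P * realization_det A B C D)
  (hdet : zeroset p `&` @bidisk R =
     [set x | \det (x.2%:M - transfer A B C D x.1) = 0] `&` @bidisk R)
  (hQfin : finite_set
     [set x | (zeroset p `&` @bidisk R) x /\ Qvec Q x.1 x.2 = 0])
  (hQeig : forall z w : R[i], (zeroset p `&` @bidisk R) (z, w) ->
     transfer A B C D z *m Qvec Q z w = w *: Qvec Q z w)
  (hQinv : forall z : R[i], normc z <= 1 -> mxpoly_eval Q z \in unitmx)
  (f : {poly {poly R[i]}}) :
  let F := extension Q (transfer A B C D) f in
  let supf := sup_on (zeroset p `&` @bidisk R) f in
  (forall z w : R[i], (zeroset p `&` @cbidisk R) (z, w) -> F z w = f.[z, w]) /\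
  (forall z w : R[i], @bidisk R (z, w) ->
     [/\ normc (F z w) <=
           opnorm (invmx (mxpoly_eval Q z)) * enorm (Qvec Q z w) * supf,
         opnorm (invmx (mxpoly_eval Q z)) * enorm (Qvec Q z w) * supf <=
           Num.sqrt m%:R * opnorm (invmx (mxpoly_eval Q z))
             * opnorm (mxpoly_eval Q z) * supf &
         Num.sqrt m%:R * opnorm (invmx (mxpoly_eval Q z))
             * opnorm (mxpoly_eval Q z) * supf <=
           bound_const Q * supf]).
Proof.
move=> F supf; have [V0_neq0 _ _] := hV.
have dw0 := distinguished_degw_neq0 hV.
have [c pE] := hp.
(* With [c = 0] the polynomial [p] would be 0, of degree 0 in [w]. *)
have c0 : c != 0.
  by apply: contraNneq dw0 => c0; rewrite pE c0 mul0r /degw sizeYE rmorph0 size_poly0.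
have pzE z w : p.[z, w] = c * (realization_det A B C D).[z, w].
  by rewrite pE !(hornerM, hornerC).
have eigV z w : normc z <= 1 -> p.[z, w] = 0 -> eigenvalue (transfer A B C D z) w.
  move=> z1; rewrite pzE => /eqP; rewrite mulf_eq0 (negPf c0)/= => /eqP.
  exact: realization_det0_eigenvalue.
have eigV0 z w : normc z < 1 -> eigenvalue (transfer A B C D z) w ->
    (zeroset p `&` @bidisk R) (z, w).
  move=> z1 ew; have [w1 nw] := transfer_eigenvalue hU hD z1 ew.
  have wlt : normc w < 1.
    (* A unimodular eigenvalue would make [p] vanish on a whole horizontal line, against
       minimality. *)
    rewrite lt_neqAle w1 andbT; apply/eqP => /[dup] w1' /nw h.
    by apply: (minimal_degree_horizontal hmin dw0 w1') => z'; rewrite pzE h mulr0.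
  rewrite hdet; split; last by split.
  have /eigenvalueP[v vw v0] := ew.
  by apply/eqP/det0P; exists v => //; rewrite mulmxBr vw mul_mx_scalar subrr.
have m0 : m != 0%N by case: hmin => _ <- _.
have supf0 : 0 <= supf by exact: sup_on_ge0.
rewrite {}/F {hmin hp hdet pE pzE c c0 hV hQfin hQdeg dw0}.
(* As [m = degw p] is positive, it can be written [k.+1], the size for which the extension lemmas
   are stated. *)
case: m m0 A B C Q hU hQeig hQinv eigV eigV0 => [//|k] _ A' B' C' Q' hU' hQeig' hQinv' eigV eigV0.
split=> [z w [pz [/= z1 _]]|z w [/= z1 w1]].
  exact: (extension_eq hU' hD eigV eigV0).
have supf_w := ler_wpM2r supf0.
split.
- by apply: (extension_bound Q' hU' hD eigV0 V0_neq0); exact: ltW.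
- apply: supf_w; rewrite [leRHS]mulrAC mulrC ler_wpM2r ?opnorm_ge0//.
  by apply: enorm_Qvec_le; exact: ltW.
- by apply: supf_w; rewrite -mulrA opnorm_le_bound_const.
Qed.
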